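(* For every $\varepsilon>0$ there exists $\Delta_0$ such that for every integer $\Delta\ge\Delta_0$ the following holds with $\delta=(192\log\Delta)^{2/\varepsilon}$. Let $G$ be a triangle-free graph of maximum degree $\Delta$, and let $L:V(G)\to 2^{\mathbb{Z}^+}$ be a list assignment of $G$ such that for all $v\in V(G)$, \[ |L(v)|\ \ge\ (1+\varepsilon)\max\left\{\frac{\deg(v)}{\log\deg(v)},\ \frac{\delta}{\log\delta}\right\}. \] Then there exists a proper colouring $c:V(G)\to\mathbb{Z}^+$ of $G$ such that $c(v)\in L(v)$ for all $v\in V(G)$.
   Context: Graphs are finite and simple; $\log$ is the natural logarithm; $\deg(v)$ is the degree of $v$ in $G$. A list assignment $L$ assigns to each vertex $v$ a set $L(v)\subseteq\mathbb{Z}^+$. A colouring $c$ is proper if $c(u)\ne c(v)$ for every edge $uv$. For vertices with $\deg(v)\le 1$, where $\deg(v)/\log\deg(v)$ is undefined, the maximum is understood to be $\delta/\log\delta$. *)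

(* Defs.v *)
From mathcomp Require Export all_boot all_order all_algebra.
From mathcomp Require Export all_classical all_reals all_analysis.

Set Implicit Arguments.
Unset Strict Implicit.
Unset Printing Implicit Defensive.

Import Order.TTheory GRing.Theory Num.Theory.

Definition simple_graph (V : finType) (adj : rel V) : Prop :=
  symmetric adj /\ irreflexive adj.

Definition triangle_free (V : finType) (adj : rel V) : Prop :=
  forall u v w : V, ~ [/\ adj u v, adj v w & adj u w].

Definition degree (V : finType) (adj : rel V) (v : V) : nat :=
  #|[set u | adj v u]|.

Definition max_degree (V : finType) (adj : rel V) : nat :=
  (\max_(v : V) degree adj v)%N.

(* Colours are the positive elements of nat; lists may be infinite. *)
Definition list_assignment (V : finType) (L : V -> set nat) : Prop :=
  forall (v : V) (k : nat), L v k -> (0 < k)%N.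

Definition proper_colouring (V : finType) (adj : rel V) (c : V -> nat) : Prop :=
  forall u v : V, adj u v -> c u <> c v.

Local Open Scope ring_scope.

Definition delta (R : realType) (eps : R) (D : nat) : R :=
  (192%:R * ln D%:R) `^ (2%:R / eps).

(* max {d / log d, delta / log delta}; for d <= 1 the quotient d / log d is
   undefined and the maximum is delta / log delta by convention. *)
Definition max_ratio (R : realType) (delta : R) (d : nat) : R :=
  if (d <= 1)%N then delta / ln delta
  else Num.max (d%:R / ln d%:R) (delta / ln delta).

(* Main.v *)
(* Rosenfeld-style counting.  Let c be a uniformly random proper list colouring
   of an induced subgraph H, and call u scarce if at most t colours of its list
   are absent from its neighbourhood, t being a constant.  By induction on H
   every u in H is scarce with probability at most q, of order 1 / log Delta.
   To add v, condition on c outside N(v): since N(v) is stable, the colours on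
   N(v) become independent and uniform on the lists of available colours.  By
   Markov's inequality few neighbours of v are scarce, and discarding the
   colours available at those costs little.  Each other neighbour takes a given
   available colour with probability less than 1 / t, so on average
   deg(v)^theta colours survive at v.  The events "x survives" are negatively
   dependent, so v ends up with few colours only with probability
   p = O(q log deg(v)) + exp(- deg(v)^theta).  Adding v thus multiplies the
   number of colourings by about deg(v)^theta, while at most t p times as many
   colourings make v scarce; the ratio is again at most q.  Degrees below delta
   are rounded up to delta, and exp(- delta^theta) is negligible against q
   because log Delta is a power of delta. *)
Require Import Defs.
From mathcomp Require Import finmap ring lra.
Import Order.TTheory GRing.Theory Num.Theory.
Local Open Scope ring_scope.

Set Implicit Arguments.
Unset Strict Implicit.
Unset Printing Implicit Defensive.

(** * Partial list colourings and their extension by one vertex *)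

Section PartialColourings.

Variables (R : realType) (V C : finType) (adj : rel V) (L : V -> {set C}).
Hypotheses (adj_sym : symmetric adj) (adj_irr : irreflexive adj).

Local Notation pcol := {ffun V -> option C}.

(** As [adj] is irreflexive, the colour of v itself is not consulted; for a coloured v these are the
    colours it could be recoloured with. *)
Definition available (c : pcol) (v : V) : {set C} :=
  [set x in L v | [forall u, adj v u ==> (c u != Some x)]].

(* The proper list colourings whose domain is exactly H. *)
Definition pcols (H : {set V}) : {set pcol} :=
  [set c : pcol |
     [forall v, if c v is Some x then (v \in H) && (x \in L v) else v \notin H]
     && [forall u, forall v, adj u v && (u \in H) ==> (c u != c v)]].

Definition upd (c : pcol) (v : V) (o : option C) : pcol :=
  [ffun u => if u == v then o else c u].

Lemma upd_upd (c : pcol) (v : V) (o o' : option C) :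
  upd (upd c v o) v o' = upd c v o'.
Proof. by apply/ffunP => u; rewrite !ffunE; case: eqP. Qed.

Lemma upd_same (c : pcol) (v : V) : upd c v (c v) = c.
Proof. by apply/ffunP => u; rewrite !ffunE; case: eqP => [->|]. Qed.

Lemma available_upd (c : pcol) (v u : V) (o : option C) :
  ~~ adj v u -> available (upd c u o) v = available c v.
Proof.
move=> nvu; apply/setP => x; rewrite !inE; congr (_ && _).
apply: eq_forallb => w; rewrite ffunE.
by have [->|] := eqVneq w u; first by rewrite (negbTE nvu).
Qed.

Lemma pcols_dom (H : {set V}) (c : pcol) (v : V) :
  c \in pcols H -> (c v == None) = (v \notin H).
Proof.
rewrite inE => /andP[/forallP/(_ v)]; case: (c v) => [x|] //.
by case/andP => -> _.
Qed.

Lemma pcols_upd (H : {set V}) (c : pcol) (v : V) (x : C) : v \notin H ->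
  (upd c v (Some x) \in pcols (v |: H)) =
  (upd c v None \in pcols H) && (x \in available c v).
Proof.
move=> vH; apply/idP/idP.
- rewrite inE => /andP[/forallP dom /forallP prop].
  have xL : x \in L v.
    by move: (dom v); rewrite ffunE eqxx !inE eqxx.
  apply/andP; split.
    rewrite inE; apply/andP; split; apply/forallP => u.
      move: (dom u); rewrite !ffunE; case: eqP => [-> //|/eqP uv].
      by rewrite !inE (negbTE uv).
    apply/forallP => w; apply/implyP => /andP[uw uH].
    have /forallP/(_ w) := prop u; rewrite uw !inE uH orbT /= !ffunE.
    have uv : u != v by apply: contraNneq vH => <-.
    rewrite (negbTE uv); case: (w =P v) => // _ _.
    move: (dom u); rewrite ffunE (negbTE uv); case: (c u) => //.
    by rewrite !inE uH orbT.
  rewrite inE xL; apply/forallP => u; apply/implyP => vu.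
  have uv : u != v by apply: contraTneq vu => ->; rewrite adj_irr.
  have /forallP/(_ u) := prop v; rewrite vu !inE eqxx /= !ffunE eqxx (negbTE uv).
  by rewrite eq_sym.
- case/andP; rewrite inE => /andP[/forallP dom /forallP prop].
  rewrite inE => /andP[xL /forallP av].
  rewrite inE; apply/andP; split; apply/forallP => u.
    move: (dom u); rewrite !ffunE; case: eqP => [->|/eqP uv].
      by rewrite !inE eqxx.
    by rewrite !inE (negbTE uv).
  apply/forallP => w; apply/implyP => /andP[uw]; rewrite !inE !ffunE.
  case: (u =P v) => [uv _|/eqP uv /= uH].
    have wv : w != v by apply: contraTneq uw => ->; rewrite uv adj_irr.
    by rewrite (negbTE wv) eq_sym; move: (av w); rewrite -uv uw.
  have /forallP/(_ w) := prop u; rewrite uw uH /= !ffunE (negbTE uv).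
  case: (w =P v) => // wv _; move: (av u); rewrite -wv adj_sym uw //.
Qed.

Lemma big_pcolsU1 (x0 : C) (H : {set V}) (v : V) (F : pcol -> R) : v \notin H ->
  \sum_(c in pcols (v |: H)) F c =
  \sum_(c in pcols H) \sum_(x in available c v) F (upd c v (Some x)).
Proof.
move=> vH; rewrite pair_big_dep /=.
rewrite (reindex_onto (fun p : pcol * C => upd p.1 v (Some p.2))
   (fun c => (upd c v None, odflt x0 (c v)))) /=; last first.
  move=> c cH; rewrite upd_upd -[RHS](upd_same c v); congr upd.
  by have := pcols_dom v cH; rewrite setU11; case: (c v).
apply: eq_bigl => -[c x] /=; rewrite pcols_upd // upd_upd ffunE eqxx /=.
rewrite xpair_eqE eqxx andbT.
(* The inverse recovers a pair only if its first component leaves v uncoloured, which holds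
   throughout [pcols H] because v is outside H. *)
have [<-|ne] := eqVneq (upd c v None) c.
  by rewrite upd_upd andbT.
rewrite andbF; apply/esym/negP => /andP[cH _].
move/eqP: ne; apply.
have /eqP := pcols_dom v cH; rewrite vH => /eqP /eqP e.
by rewrite -[RHS](upd_same c v) e.
Qed.

End PartialColourings.

(** Draw y with law g and raise the factor at y from a to 1. At most one factor is raised, so the
    factors are negatively correlated and the mean of the product is at most the product of the
    means. *)
Lemma expected_prod_but_one_le (R : realType) (C : finType) (g a : C -> R) (r : seq C) :
  uniq r -> \sum_y g y = 1 -> (forall y, 0 <= g y) ->
  (forall x, 0 <= a x <= 1) ->
  \sum_y g y * \prod_(x <- r) (if x == y then 1 else a x) <=
  \prod_(x <- r) (a x + g x * (1 - a x)).
Proof.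
move=> + g1 g0 a01; elim: r => [|z r IHr] /=.
  by move=> _; under eq_bigr do rewrite big_nil mulr1; rewrite g1 big_nil.
case/andP => zr /IHr {}IHr; rewrite big_cons.
have /andP[az0 az1] := a01 z.
(* The factor at z is [a z], plus [1 - a z] when y = z; in that event no factor of r is raised,
   because z is not in r. *)
have -> : \sum_y g y * \prod_(x <- z :: r) (if x == y then 1 else a x) =
    a z * \sum_y g y * \prod_(x <- r) (if x == y then 1 else a x)
    + g z * (1 - a z) * \prod_(x <- r) a x.
  have -> : \prod_(x <- r) a x = \prod_(x <- r) (if x == z then 1 else a x).
    rewrite big_seq [RHS]big_seq; apply: eq_bigr => x xr.
    by case: eqP => // xz; rewrite -xz xr in zr.
  rewrite mulr_sumr [LHS](bigD1 z) //= [X in _ = X + _](bigD1 z) //=.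
  rewrite big_cons eqxx mul1r [RHS]addrAC; congr (_ + _).
    by rewrite -mulrA !mulrA -!mulrDl; congr (_ * _); ring.
  apply: eq_bigr => y yz; rewrite big_cons eq_sym (negbTE yz); ring.
rewrite mulrDl; apply: lerD; first by rewrite ler_wpM2l.
rewrite ler_wpM2l ?mulr_ge0 ?subr_ge0 //.
apply: ler_prod => x _; have /andP[ax0 ax1] := a01 x.
by rewrite ax0 lerDl mulr_ge0 ?subr_ge0.
Qed.

Section NegativeDependence.

Variables (R : realType) (V C : finType) (adj : rel V) (L : V -> {set C}).
Hypotheses (adj_sym : symmetric adj) (adj_irr : irreflexive adj).

Local Notation pcol := {ffun V -> option C}.

Definition uses (c : pcol) (S : {set V}) (x : C) : bool :=
  [exists u in S, c u == Some x].

(* The probability that no vertex of S gets colour x when each u in S picks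
   a uniform element of [available adj L c u] (a factor is 1 if that set is
   empty, as division by 0 gives 0). *)
Definition avoid_prob (c : pcol) (S : {set V}) (x : C) : R :=
  \prod_(u in S)
    (1 - (x \in available adj L c u)%:R / #|available adj L c u|%:R).

Lemma avoid_prob_ge0_le1 (c : pcol) (S : {set V}) (x : C) :
  0 <= avoid_prob c S x <= 1.
Proof.
have H u : 0 <= ((x \in available adj L c u)%:R
              / #|available adj L c u|%:R : R) <= 1.
  case: (boolP (x \in _)) => [xA|_]; last by rewrite mul0r lexx ler01.
  have A0 : (0 < #|available adj L c u|)%N by apply/card_gt0P; exists x.
  by rewrite divr_ge0 //= ler_pdivrMr ?ltr0n // mul1r ler_nat.
have H' u : 0 <= 1 - ((x \in available adj L c u)%:R
                      / #|available adj L c u|%:R : R) <= 1.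
  by have /andP[? ?] := H u; rewrite subr_ge0 gerBl; apply/andP.
rewrite /avoid_prob prodr_ile1 // prodr_ge0 // => u _.
by have /andP[] := H' u.
Qed.

(* Negative dependence of the events "x is not used on S", in the form of a
   generating function; taking w = exp(-1) gives a Chernoff bound.  As Phi
   ignores the colours on S, this holds conditionally on the rest of c. *)
Lemma sum_pcols_unused_le (x0 : C) (X : {set C}) (S H : {set V})
    (Phi : pcol -> R) (w : C -> R) :
  (forall u v, u \in S -> v \in S -> ~~ adj u v) ->
  [disjoint S & H] ->
  (forall c, 0 <= Phi c) ->
  (forall c u o, u \in S -> Phi (upd c u o) = Phi c) ->
  (forall x, 0 <= w x <= 1) ->
  \sum_(c in pcols adj L (S :|: H))
     Phi c * \prod_(x in X) (if uses c S x then 1 else w x) <=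
  \sum_(c in pcols adj L (S :|: H))
     Phi c * \prod_(x in X) (1 - (1 - w x) * avoid_prob c S x).
Proof.
have [n] := ubnP #|S|; elim: n => // n IHn in S Phi w *.
move=> Sn stable dis Phi0 PhiS w01.
have [S0|[u uS]] := set_0Vmem S.
  apply: ler_sum => c _; rewrite ler_wpM2l //.
  apply: ler_prod => x _; rewrite /uses /avoid_prob S0 big_set0 mulr1 opprB.
  rewrite addrC subrK; case: existsP => [[v]|_]; first by rewrite inE.
  by have /andP[-> _] := w01 x; rewrite /= lexx.
pose S' := S :\ u.
have uS' : u \notin S' by rewrite !inE eqxx.
have SE : S = u |: S' by rewrite finset.setD1K.
have uH : u \notin H by rewrite (disjointFr dis).
have uSH : u \notin S' :|: H by rewrite inE negb_or uS'.
have S'S v : v \in S' -> v \in S by rewrite !inE => /andP[].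
rewrite SE -finset.setUA !(big_pcolsU1 L adj_sym adj_irr x0) //.
pose av := available adj L.
have avu c y v : v \in S -> av (upd c u y) v = av c v.
  by move=> vS; rewrite /av available_upd ?stable.
have usesE c x y : uses (upd c u (Some y)) (u |: S') x = (x == y) || uses c S' x.
  apply/existsP/idP => [[v]|].
    rewrite !inE ffunE; case: (v =P u) => [_ /=|/eqP vu /=].
      by case/eqP => ->; rewrite eqxx.
    move=> H0; apply/orP; right; apply/existsP; exists v.
    by rewrite !inE vu.
  case/orP => [/eqP ->|/existsP[v /andP[vS' cv]]].
    by exists u; rewrite finset.setU11 ffunE eqxx /=.
  exists v; rewrite inE vS' orbT ffunE; have [vu|_] := eqVneq v u; last exact: cv.
  by rewrite -vu vS' in uS'.
(* Giving u colour y makes y used: its weight rises to 1, and the condition that y be available at u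
   moves into [Psi]. Hence the induction over all Phi and w. *)
pose w' y x := if x == y then 1 else w x.
pose Psi y (c : pcol) : R := Phi c * (y \in av c u)%:R.
pose a y c x := 1 - (1 - w' y x) * avoid_prob c S' x.
apply: (@le_trans _ _ (\sum_y \sum_(c in pcols adj L (S' :|: H))
          Psi y c * \prod_(x in X) a y c x)).
  rewrite exchange_big /=.
  under eq_bigr => c _ do rewrite big_mkcond.
  rewrite exchange_big /= [leRHS]exchange_big /=; apply: ler_sum => y _.
  apply: le_trans (IHn S' (Psi y) (w' y) _ _ _ _ _ _).
  - apply: ler_sum => c _; rewrite /Psi /av; case: ifP => yc /=.
      rewrite mulr1 PhiS // ler_wpM2l //; apply: ler_prod => x _.
      rewrite usesE /w'; case: (x == y) => /=.
        by case: ifP; rewrite ler01 lexx.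
      by case: ifP => _; rewrite ?ler01 ?lexx // andbT; have /andP[] := w01 x.
    by rewrite mulr0 mul0r.
  - by rewrite -ltnS; apply: leq_trans Sn; rewrite [in X in (_ < X)%N]SE cardsU1 uS'.
  - by move=> v v' /S'S vS /S'S; apply: stable.
  - by rewrite SE in dis; apply: disjointWl dis; apply: finset.subsetUr.
  - by move=> c; rewrite mulr_ge0.
  - by move=> c v o /S'S vS; rewrite /Psi PhiS // /av available_upd // stable.
  - by move=> x; rewrite /w'; case: ifP => // _; rewrite ler01 lexx.
rewrite exchange_big /=; apply: ler_sum => c cH.
set k : R := #|av c u|%:R.
have avoidE x y : avoid_prob (upd c u (Some y)) (u |: S') x =
    (1 - (x \in av c u)%:R / k) * avoid_prob c S' x.
  rewrite /avoid_prob big_setU1 //= -!/(av _ _) avu //; congr (_ * _).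
  by apply: eq_bigr => v /S'S vS; rewrite -!/(av _ _) avu.
have [k0|k0] := eqVneq #|av c u| 0%N.
  have c0 y : (y \in av c u) = false by move/cards0_eq: k0 => ->; rewrite inE.
  by rewrite !big1 // => y; rewrite ?c0 // /Psi c0 mulr0 mul0r.
have kgt0 : 0 < k by rewrite ltr0n lt0n.
under [leRHS]eq_bigr => y yc.
  rewrite PhiS //.
  under eq_bigr => x _ do rewrite avoidE.
  over.
rewrite sumr_const -mulr_natl -/k.
rewrite /Psi; under eq_bigr => y _ do rewrite -mulrA.
rewrite -mulr_sumr mulrCA ler_wpM2l //.
(* [b x] is the factor for S' and g the uniform law of the colour of u; then [b x + g x * (1 - b x)]
   is exactly the factor for S. *)
pose b x := 1 - (1 - w x) * avoid_prob c S' x.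
pose g y := (y \in av c u)%:R / k.
have b01 x : 0 <= b x <= 1.
  have /andP[w0 w1] := w01 x; have /andP[p0 p1] := avoid_prob_ge0_le1 c S' x.
  rewrite /b subr_ge0 gerBl mulr_ge0 ?subr_ge0 // andbT.
  by rewrite -[leRHS]mulr1 ler_pM ?subr_ge0 // gerBl.
have g1 : \sum_y g y = 1.
  have -> : \sum_y g y = (\sum_y (y \in av c u : nat))%N%:R / k.
    by rewrite natr_sum mulr_suml.
  have -> : (\sum_y (y \in av c u : nat))%N = #|av c u|.
    by rewrite -sum1_card [RHS]big_mkcond; apply: eq_bigr => y _; case: (y \in _).
  by rewrite mulfV ?gt_eqF.
have g0 y : 0 <= g y by rewrite divr_ge0 // ltW.
have h := expected_prod_but_one_le (enum_uniq X) g1 g0 b01.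
rewrite big_enum /= in h.
apply: (@le_trans _ _ (k * \prod_(x in X) (b x + g x * (1 - b x)))).
  move: h; rewrite -(ler_pM2l kgt0) mulr_sumr; apply: le_trans.
  apply: ler_sum => y _; rewrite mulrA /g mulrCA mulfV ?gt_eqF // mulr1.
  rewrite ler_wpM2l // big_enum /=; apply: ler_prod => x _.
  rewrite /a /w'; case: ifP => _; first by rewrite subrr mul0r subr0 lexx ler01.
  by have /andP[-> _] := b01 x; rewrite /= lexx.
apply: ler_wpM2l; first exact: ltW.
apply: ler_prod => x _.
have /andP[b0 b1] := b01 x; apply/andP; split.
  by apply: addr_ge0 => //; apply: mulr_ge0 => //; rewrite subr_ge0.
by rewrite /b /g le_eqVlt; apply/orP; left; apply/eqP; ring.
Qed.

End NegativeDependence.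

(** * The mean number of surviving colours *)

Lemma natr_card_setI_pred (R : realType) (T : finType) (P : {set T}) (Q : pred T) :
  #|[set c in P | Q c]|%:R = \sum_(c in P) (Q c)%:R :> R.
Proof.
rewrite -natr_sum -sum1_card; congr _%:R.
rewrite (eq_bigl (fun c => (c \in P) && Q c)) => [|c]; last by rewrite inE.
by rewrite big_mkcondr /=; apply: eq_bigr => c _; case: (Q c).
Qed.

(** The left side is the tangent at a of the convex function on the right; summed over colours, it
    stands in for Jensen's inequality. *)
Lemma expR_tangent_ge (R : realType) (a y : R) :
  expR (- a) * (1 + a - y) <= expR (- y).
Proof.
have -> : expR (- y) = expR (- a) * expR (a - y).
  by rewrite -expRD; congr expR; ring.
by rewrite ler_wpM2l ?expR_ge0 // -addrA expR_ge1Dx.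
Qed.

(** Colours in a list of size at most t are discarded, at most t beta of them. On the rest each
    factor is at least an exponential, and the exponents have a bounded total since each list has
    total weight at most 1; convexity does the rest. *)
Lemma sum_prod_avoid_ge (R : realType) (V C : finType) (A : V -> {set C})
    (S : {set V}) (X : {set C}) (t : nat) (beta m : R) :
  (0 < t)%N ->
  #|[set u in S | (#|A u| <= t)%N]|%:R <= beta ->
  m <= #|X|%:R - t%:R * beta -> 0 < m ->
  m * expR (- ((1 + t%:R^-1) * #|S|%:R / m)) <=
  \sum_(x in X) \prod_(u in S) (1 - (x \in A u)%:R / #|A u|%:R).
Proof.
move=> t0 badbeta mX m0.
set bad := [set u in S | _] in badbeta.
pose X' := X :\: \bigcup_(u in bad) A u.
have X'X : X' \subset X by apply: finset.subsetDl.
have X'bad x u : x \in X' -> u \in bad -> x \notin A u.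
  rewrite inE => /andP[/bigcupP xA _] ub; apply/negP => xu.
  by apply: xA; exists u.
have cardX' : m <= #|X'|%:R.
  apply: le_trans mX _; rewrite lerBlDr.
  have cardU : (#|\bigcup_(u in bad) A u| <= t * #|bad|)%N.
    rewrite mulnC -sum_nat_const.
    apply: (big_ind2 (fun (B : {set C}) n => (#|B| <= n)%N)).
    - by rewrite cards0.
    - move=> B n B' n' Bn B'n'; apply: leq_trans (leq_add Bn B'n').
      exact: leq_card_setU.
    - by move=> u; rewrite inE => /andP[].
  apply: (@le_trans _ _ (#|X'|%:R + (t * #|bad|)%:R)); last first.
    by rewrite lerD2l natrM ler_wpM2l.
  rewrite -natrD ler_nat; apply: leq_trans (leq_add (leqnn _) cardU).
  rewrite -(cardsID (\bigcup_(u in bad) A u) X) addnC leq_add2l.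
  by apply: subset_leq_card; apply: finset.subsetIr.
have tR : 0 < t%:R :> R by rewrite ltr0n.
set r := 1 + t%:R^-1.
have r0 : 0 < r by rewrite addr_gt0 // invr_gt0.
pose s x : R := \sum_(u in S) (x \in A u)%:R / #|A u|%:R.
have factor x u : x \in X' -> u \in S ->
    expR (- (r * ((x \in A u)%:R / #|A u|%:R))) <=
    1 - (x \in A u)%:R / #|A u|%:R.
  move=> xX' uS; case: (boolP (x \in A u)) => xu; last first.
    by rewrite mul0r mulr0 oppr0 expR0 addr0.
  have tA : (t < #|A u|)%N.
    rewrite ltnNge; apply: contraL xu => At.
    by apply: X'bad => //; rewrite inE uS.
  set l : R := #|A u|%:R.
  have tl : t%:R + 1 <= l by rewrite natr1 ler_nat.
  have l0 : 0 < l by apply: lt_le_trans tl; rewrite addr_gt0.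
  rewrite mul1r expRN -[leLHS]mul1r ler_pdivrMr ?expR_gt0 //.
  (* The value r = 1 + 1/t makes this product equal to 1 at l = t + 1, the least size of a list that
     is not short. *)
  apply: (@le_trans _ _ ((1 - l^-1) * (1 + r * l^-1))); last first.
    apply: ler_wpM2l; last exact: expR_ge1Dx.
    rewrite subr_ge0 invf_le1 //; apply: le_trans tl.
    by rewrite lerDr ltW.
  rewrite -subr_ge0.
  have -> : (1 - l^-1) * (1 + r * l^-1) - 1 =
            l^-1 ^+ 2 * t%:R^-1 * (l - (t%:R + 1)).
    by rewrite /r; field; rewrite !gt_eqF.
  by rewrite !mulr_ge0 ?exprn_ge0 ?invr_ge0 ?subr_ge0 // ltW.
(* The tangent point: an upper bound for the mean of [r * s x] over X', which has at least m
   colours. *)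
set a := r * #|S|%:R / m.
apply: (@le_trans _ _ (\sum_(x in X') expR (- a) * (1 + a - r * s x))); last first.
  apply: (@le_trans _ _ (\sum_(x in X') \prod_(u in S)
      (1 - (x \in A u)%:R / #|A u|%:R))).
    apply: ler_sum => x xX'; apply: le_trans (expR_tangent_ge _ _) _.
    rewrite /s mulr_sumr -sumrN expR_sum; apply: ler_prod => u uS.
    by rewrite expR_ge0 /=; apply: factor.
  rewrite [leRHS](big_setID X') /=.
  have -> : X :&: X' = X' by apply/finset.setIidPr.
  rewrite lerDl sumr_ge0 // => x _; rewrite prodr_ge0 // => u _.
  rewrite subr_ge0; case: (boolP (x \in A u)) => [xu|]; last by rewrite mul0r.
  have A0 : (0 < #|A u|)%N by apply/card_gt0P; exists x.
  by rewrite ler_pdivrMr ?ltr0n // mul1r ler_nat.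
rewrite -mulr_sumr mulrC ler_wpM2l ?expR_ge0 //.
rewrite big_split /= sumrN -mulr_sumr sumr_const -[_ *+ _]mulr_natr.
have sS : \sum_(x in X') s x <= #|S|%:R.
  rewrite /s exchange_big /= -sum1_card natr_sum; apply: ler_sum => u _.
  rewrite -mulr_suml; have [->|A0] := posnP #|A u|; first by rewrite invr0 mulr0.
  rewrite ler_pdivrMr ?ltr0n // mul1r -natr_card_setI_pred ler_nat.
  by apply: subset_leq_card; apply/fintype.subsetP => x; rewrite inE => /andP[].
apply: (@le_trans _ _ ((1 + a) * m - r * #|S|%:R)).
  by rewrite /a mulrDl mul1r divfK ?gt_eqF // addrK.
rewrite lerB ?ler_wpM2l ?(ltW r0) // addr_ge0 // /a.
by rewrite mulr_ge0 ?invr_ge0 ?(ltW m0) // mulr_ge0 // ltW.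
Qed.

(** * Lower tail of the number of available colours *)

Section Tail.

Variables (R : realType) (V C : finType) (adj : rel V) (L : V -> {set C}).
Hypotheses (adj_sym : symmetric adj) (adj_irr : irreflexive adj).
Hypothesis adj_tri : triangle_free adj.

Local Notation pcol := {ffun V -> option C}.

Definition scarce_nbrs (t : nat) (H : {set V}) (c : pcol) (v : V) : {set V} :=
  [set u in [set u in H | adj v u] | (#|available adj L c u| <= t)%N].

(** The neighbours of v in H form a stable set S, so recolouring S changes neither the lists
    available on S nor the set of scarce neighbours; Phi can thus be the indicator of few scarce
    neighbours. The mean number of surviving colours is then at least a, and a / 2 comes from 1 -
    exp(- 1) >= 1 / 2. *)
Lemma few_available_le (x0 : C) (H : {set V}) (v : V) (t : nat)
    (beta m a T : R) :
  v \notin H -> (0 < t)%N ->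
  m <= #|L v|%:R - t%:R * beta -> 0 < m ->
  a <= m * expR (- ((1 + t%:R^-1) * (degree adj v)%:R / m)) ->
  \sum_(c in pcols adj L H) ((#|scarce_nbrs t H c v|%:R <= beta)
     && (#|available adj L c v|%:R <= T))%:R <=
  expR (T - a / 2) * #|pcols adj L H|%:R.
Proof.
move=> vH t0 mX m0 am.
pose S := [set u in H | adj v u].
have stable u u' : u \in S -> u' \in S -> ~~ adj u u'.
  rewrite !inE => /andP[_ vu] /andP[_ vu']; apply/negP => uu'.
  exact: (@adj_tri v u u').
have SH : S \subset H by apply/fintype.subsetP => u; rewrite inE => /andP[].
have HE : H = S :|: (H :\: S).
  by rewrite -[LHS](finset.setID H S); congr (_ :|: _); apply/finset.setIidPr.
pose Phi c : R := (#|scarce_nbrs t H c v|%:R <= beta)%R%:R.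
pose w : R := expR (- 1).
have w01 : 0 <= w <= 1.
  by rewrite /w expR_ge0 -[leRHS]expR0 ler_expR lerN10.
have w2 : 2^-1 <= 1 - w.
  suff: w <= 2^-1 by lra.
  rewrite /w expRN lef_pV2 ?posrE ?expR_gt0 //.
  by have := expR_ge1Dx (1 : R); lra.
apply: (@le_trans _ _ (expR T * \sum_(c in pcols adj L H)
    Phi c * \prod_(x in L v) (if uses c S x then 1 else w))).
  rewrite mulr_sumr; apply: ler_sum => c cH.
  have -> : \prod_(x in L v) (if uses c S x then 1 else w) =
            expR (- #|available adj L c v|%:R).
    transitivity (\prod_(x in L v) (if ~~ uses c S x then w else 1)).
      by apply: eq_bigr => x _; case: uses.
    rewrite -big_mkcondr /= -mulN1r expRM_natr -/w -prodr_const.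
    apply: eq_bigl => x; rewrite inE; congr (_ && _).
    apply/negP/forallP => [nu u|fu /existsP[u /andP[]]].
      apply/implyP => vu; apply/negP => cu; apply: nu; apply/existsP; exists u.
      rewrite cu inE vu !andbT -[_ \in _]negbK -(pcols_dom u cH).
      by rewrite (eqP cu).
    by rewrite inE => /andP[_ vu] cu; have := fu u; rewrite vu cu.
  rewrite mulrCA -expRD /Phi; case: (_ <= beta); rewrite /= ?mul0r // mul1r.
  case: (leP _ T) => lT; last exact: expR_ge0.
  by rewrite -[leLHS]expR0 ler_expR subr_ge0.
rewrite expRD -mulrA ler_wpM2l ?expR_ge0 //.
have := @sum_pcols_unused_le R _ _ _ L adj_sym adj_irr x0 (L v) S (H :\: S)
  Phi (fun=> w) stable.
rewrite -HE => /(_ _ _ _ _)/le_trans; apply => //.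
- rewrite finset.disjoints_subset; apply/fintype.subsetP => u.
  by rewrite !inE => ->.
- move=> c u o uS; rewrite /Phi.
  suff -> : scarce_nbrs t H (upd c u o) v = scarce_nbrs t H c v by [].
  apply/setP => u'; rewrite !inE.
  case: (boolP (_ && adj v u')) => //= /andP[u'H vu'].
  by rewrite available_upd // stable // inE u'H.
rewrite mulrC -sum1_card natr_sum mulr_suml; apply: ler_sum => c cH.
rewrite mul1r /Phi; case: (boolP (_ <= beta)) => bad; last first.
  by rewrite mul0r expR_ge0.
rewrite mul1r.
have p01 := avoid_prob_ge0_le1 R adj L c S.
apply: (@le_trans _ _ (\prod_(x in L v) expR (- (avoid_prob R adj L c S x / 2)))).
  apply: ler_prod => x _; have /andP[p0 p1] := p01 x.
  have /andP[w0 w1] := w01.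
  apply/andP; split; first by nra.
  apply: le_trans (expR_ge1Dx _); nra.
rewrite -expR_sum ler_expR sumrN lerN2 -mulr_suml ler_wpM2r //.
apply: le_trans am _.
apply: le_trans (sum_prod_avoid_ge t0 bad mX m0).
apply: ler_wpM2l; first exact: ltW.
rewrite ler_expR lerN2 ler_wpM2r ?invr_ge0 ?(ltW m0) //.
rewrite ler_wpM2l ?addr_ge0 ?invr_ge0 // ler_nat.
by apply: subset_leq_card; apply/fintype.subsetP => u; rewrite !inE => /andP[].
Qed.

End Tail.

(** * Induction over the vertices *)

Section Counting.

Variables (R : realType) (V C : finType) (adj : rel V) (L : V -> {set C}).
Hypotheses (adj_sym : symmetric adj) (adj_irr : irreflexive adj).
Hypothesis adj_tri : triangle_free adj.

Local Notation pcol := {ffun V -> option C}.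

Variables (t : nat) (q : R) (beta m a : V -> R).

(** Bounds the probability that at most [a v / 4] colours are available at v: Markov's inequality
    for more than [beta v] scarce neighbours, plus the tail bound at T = a/4, where T - a/2 = -
    a/4. *)
Definition few_prob (v : V) : R :=
  (degree adj v)%:R * q / beta v + expR (- (a v / 4)).

Hypotheses (t0 : (0 < t)%N) (q0 : 0 <= q).
Hypothesis beta_gt0 : forall v, 0 < beta v.
Hypothesis m_gt0 : forall v, 0 < m v.
Hypothesis m_le : forall v, m v <= #|L v|%:R - t%:R * beta v.
Hypothesis a_le : forall v,
  a v <= m v * expR (- ((1 + t%:R^-1) * (degree adj v)%:R / m v)).
Hypothesis few_prob_lt1 : forall v, few_prob v < 1.
Hypothesis t_le : forall v, t%:R <= a v / 4.
Hypothesis few_prob_le : forall v,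
  t%:R * few_prob v <= q * (a v / 4 * (1 - few_prob v)).

Definition scarce_pcols (H : {set V}) (v : V) : {set pcol} :=
  [set c in pcols adj L H | (#|available adj L c v| <= t)%N].

Lemma sum_scarce_nbrs (H : {set V}) (v : V) :
  \sum_(c in pcols adj L H) #|scarce_nbrs adj L t H c v|%:R =
  \sum_(u in [set u in H | adj v u]) #|scarce_pcols H u|%:R :> R.
Proof.
under eq_bigr do rewrite natr_card_setI_pred.
under [RHS]eq_bigr do rewrite natr_card_setI_pred.
by rewrite exchange_big.
Qed.

Lemma sum_few_available_le (x0 : C) (H : {set V}) (v : V) : v \notin H ->
  (forall u, u \in H -> #|scarce_pcols H u|%:R <= q * #|pcols adj L H|%:R) ->
  \sum_(c in pcols adj L H) (#|available adj L c v|%:R <= a v / 4)%R%:R <=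
  few_prob v * #|pcols adj L H|%:R.
Proof.
move=> vH IH; set N : R := #|pcols adj L H|%:R.
have markov : \sum_(c in pcols adj L H)
    (beta v < #|scarce_nbrs adj L t H c v|%:R)%R%:R <=
    (degree adj v)%:R * q / beta v * N.
  rewrite mulrAC ler_pdivlMr // mulr_suml.
  apply: (@le_trans _ _ (\sum_(c in pcols adj L H)
                           #|scarce_nbrs adj L t H c v|%:R)).
    apply: ler_sum => c _; case: ltP => [/ltW|_]; first by rewrite mul1r.
    by rewrite mul0r.
  rewrite sum_scarce_nbrs -mulrA.
  apply: (@le_trans _ _ (\sum_(u in [set u in H | adj v u]) q * N)).
    by apply: ler_sum => u; rewrite inE => /andP[uH _]; apply: IH.
  rewrite sumr_const -[leLHS]mulr_natl ler_wpM2r ?mulr_ge0 // ler_nat.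
  by apply: subset_leq_card; apply/fintype.subsetP => u; rewrite !inE => /andP[].
rewrite mulrDl.
have tail := few_available_le adj_sym adj_irr adj_tri x0 (a v / 4) vH t0
  (m_le v) (m_gt0 v) (a_le v).
have e : a v / 4 - a v / 2 = - (a v / 4) by field.
rewrite e in tail.
apply: le_trans (lerD markov tail); rewrite -big_split /=.
apply: ler_sum => c _; rewrite [_ < #|_|%:R]ltNge.
by case: (_ <= beta v); rewrite /= ?add0r // addr0 lern1 leq_b1.
Qed.

Lemma card_pcolsU1 (x0 : C) (H : {set V}) (v : V) : v \notin H ->
  #|pcols adj L (v |: H)|%:R =
  \sum_(c in pcols adj L H) #|available adj L c v|%:R :> R.
Proof.
move=> vH; rewrite -sum1_card natr_sum (big_pcolsU1 L adj_sym adj_irr x0) //.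
by apply: eq_bigr => c _; rewrite -sum1_card natr_sum.
Qed.

(** Colouring v does not change what is available at v, so a colouring scarce at v restricts to one
    of H with at most t colours at v, and each such one has at most t extensions. *)
Lemma card_scarce_pcolsU1_le (x0 : C) (H : {set V}) (v : V) : v \notin H ->
  #|scarce_pcols (v |: H) v|%:R <=
  t%:R * \sum_(c in pcols adj L H) (#|available adj L c v| <= t)%N%:R :> R.
Proof.
move=> vH; rewrite natr_card_setI_pred (big_pcolsU1 L adj_sym adj_irr x0) //.
rewrite mulr_sumr; apply: ler_sum => c _.
under eq_bigr do rewrite available_upd ?adj_irr //.
rewrite sumr_const -[leLHS]mulr_natl; case: leqP => ct; last by rewrite !mulr0.
by rewrite !mulr1 ler_nat.
Qed.

(* A uniform colouring of H leaves few colours at a new vertex v with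
   probability p = [few_prob v], hence H + v has at least a/4 (1 - p) times as
   many colourings as H, at most t p times as many being scarce at v. *)
Lemma pcols_gt0_scarce_le (H : {set V}) :
  (0 < #|pcols adj L H|)%N /\
  forall v, v \in H -> #|scarce_pcols H v|%:R <= q * #|pcols adj L H|%:R.
Proof.
have [n] := ubnP #|H|; elim: n => // n IHn in H *; move=> Hn.
(* Any vertex of H may be taken as the last one added, so the scarcity bound follows at every
   vertex. *)
have step v : v \in H -> (0 < #|pcols adj L H|)%N /\
    #|scarce_pcols H v|%:R <= q * #|pcols adj L H|%:R.
  move=> vH; pose H' := H :\ v.
  have vH' : v \notin H' by rewrite !inE eqxx.
  have HE : H = v |: H' by rewrite finset.setD1K.
  have [x0 _] : exists x, x \in L v.
    apply/card_gt0P; rewrite -(ltr0n R).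
    have := m_gt0 v; have := m_le v; have : 0 <= t%:R * beta v.
      by rewrite mulr_ge0 // ltW.
    by lra.
  have [|N0 IH] := IHn H'.
    by rewrite -ltnS; apply: leq_trans Hn; rewrite [in X in (_ < X)%N]HE cardsU1 vH'.
  have few := sum_few_available_le x0 vH' IH.
  rewrite HE; set N : R := #|pcols adj L H'|%:R in few *.
  have Ngt0 : 0 < N by rewrite ltr0n.
  have p1 := few_prob_lt1 v.
  have a0 : 0 < a v / 4 by apply: lt_le_trans (t_le v); rewrite ltr0n.
  (* Only colourings with more than [a v / 4] available colours at v are counted, each with
     [a v / 4] extensions. *)
  have many : a v / 4 * (1 - few_prob v) * N <= #|pcols adj L (v |: H')|%:R.
    rewrite (card_pcolsU1 x0) // -mulrA mulrBl mul1r.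
    apply: (@le_trans _ _ (a v / 4 * \sum_(c in pcols adj L H')
                    (1 - (#|available adj L c v|%:R <= a v / 4)%R%:R))).
      rewrite ler_wpM2l ?(ltW a0) // sumrB lerB //.
      by rewrite /N -sum1_card natr_sum.
    rewrite mulr_sumr; apply: ler_sum => c _.
    case: (leP #|available adj L c v|%:R (a v / 4)) => [_|/ltW] /=.
      by rewrite subrr mulr0.
    by rewrite subr0 mulr1.
  split.
    rewrite -(ltr0n R); apply: lt_le_trans many.
    by apply: mulr_gt0 => //; apply: mulr_gt0 => //; rewrite subr_gt0.
  apply: le_trans (card_scarce_pcolsU1_le x0 vH') _.
  apply: (@le_trans _ _ (t%:R * (few_prob v * N))).
    rewrite ler_wpM2l //; apply: le_trans few; apply: ler_sum => c _.
    case: leqP => [ct|_]; last exact: ler0n.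
    suff -> : #|available adj L c v|%:R <= a v / 4 by [].
    by apply: le_trans (t_le v); rewrite ler_nat.
  apply: le_trans (ler_wpM2l q0 many).
  have h := few_prob_le v; rewrite -(ler_pM2r Ngt0) in h.
  by move: h; rewrite !mulrA.
split; last by move=> v /step [].
have [->|[v /step []//]] := set_0Vmem H.
apply/card_gt0P; exists [ffun=> None]; rewrite inE.
apply/andP; split; apply/forallP => u; first by rewrite ffunE inE.
by apply/forallP => w; rewrite inE andbF.
Qed.

Lemma list_colouring_exists :
  exists c : V -> C, (forall u v, adj u v -> c u <> c v) /\
                     (forall v, c v \in L v).
Proof.
have [/card_gt0P[c]] := pcols_gt0_scarce_le [set: V].
rewrite inE => /andP[/forallP dom /forallP prop] _.
have cL v : {x | c v = Some x & x \in L v}.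
  move: (dom v); rewrite inE; case: (c v) => //= x xL; by exists x.
exists (fun v => s2val (cL v)); split; last by move=> v; case: (cL v).
move=> u v uv; case: (cL u) (cL v) => [x cu _] [y cv _] /= xy.
have /forallP/(_ v) := prop u.
by rewrite uv inE cu cv xy eqxx.
Qed.

End Counting.

(** * Reduction to finite lists *)

Lemma counting_ge_seq (R : realType) (A : set nat) (r : R) :
  (r%:E <= (counting A : \bar R))%E ->
  exists s : seq nat, [/\ uniq s, {in s, forall x, A x} & r <= (size s)%:R].
Proof.
rewrite /counting; case: asboolP => [finA|infA _].
  rewrite lee_fin => rA; exists (enum_fset (fset_set A)); split => //.
    exact: fset_uniq.
  by move=> x xA; have : x \in fset_set A by []; rewrite in_fset_set // => /set_mem.
have [B BA sB] := infinite_set_fset (Num.trunc r).+1 infA.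
exists (enum_fset B); split; first exact: fset_uniq.
  by move=> x xB; apply: BA.
apply: ltW; apply: lt_le_trans (truncnS_gt r) _.
by rewrite ler_nat.
Qed.

(** Counting needs a finite set of colours: each list, possibly infinite, is cut down to a finite
    one that is still long enough, and n exceeds every colour kept. *)
Lemma finite_sublists (R : realType) (V : finType) (L : V -> set nat) (r : V -> R) :
  (forall v, ((r v)%:E <= (counting (L v) : \bar R))%E) ->
  exists n (L' : V -> {set 'I_n}),
    (forall v, r v <= #|L' v|%:R) /\
    (forall v (x : 'I_n), x \in L' v -> L v x).
Proof.
move=> rL; have /choice[s sP] := fun v => counting_ge_seq (rL v).
pose n := (\max_(v : V) \max_(x <- s v) x.+1)%N.
exists n, (fun v => [set x : 'I_n | (x : nat) \in s v]); split => v.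
  have [us _ rs] := sP v; apply: le_trans rs _; rewrite ler_nat.
  rewrite cardE -(size_map val); apply: uniq_leq_size => // x xs.
  have xn : (x < n)%N.
    apply: leq_trans (leq_bigmax v).
    exact: (@leq_bigmax_seq _ _ xpredT (fun x => x.+1)).
  by apply/mapP; exists (Ordinal xn) => //; rewrite mem_enum inE.
by move=> x; rewrite inE => xs; have [_ + _] := sP v; apply.
Qed.

(** * Numerical estimates *)

(** The hypotheses of the counting argument at one vertex, with s its rounded log degree, k its list
    size and Lam = 192 log Delta. The choice of eta gives t beta = a k, and that of q makes the
    Markov term at most s / (4 Lam) <= 1/4. *)
Lemma constants_suffice (R : realType) (a M s Lam k d : R) (t : nat) :
  0 < a -> a <= 8^-1 -> 0 <= M -> (0 < t)%N -> t%:R^-1 <= a -> 0 < s ->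
  (1 + 8 * a) * (expR s / s) <= k -> 0 <= d -> d <= expR s ->
  s <= Lam -> Lam <= expR (M * s) ->
  32 * M / a ^+ 2 <= expR (a * s / 4) ->
  128 * t%:R ^+ 2 / a ^+ 3 <= expR (a * s / 4) ->
  let eta := a / t%:R in
  let q := eta / (4 * Lam) in
  let A := a / 2 * expR (a * s / 4) ^+ 2 in
  let m := (1 - a) * k in
  let beta := eta * k in
  let p := d * q / beta + expR (- (A / 4)) in
  [/\ 0 < beta, 0 < m, m <= k - t%:R * beta &
      A <= m * expR (- ((1 + t%:R^-1) * d / m))] /\
  [/\ p < 1, t%:R <= A / 4 & t%:R * p <= q * (A / 4 * (1 - p))].
Proof.
move=> a_gt0 a_le M_ge0 t_gt0 at1 s_gt0 k_ge d_ge0 d_le s_le Lam_le.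
set y := expR (a * s / 4) => y_ge1 y_ge2 eta q A m beta p.
have tR : 0 < t%:R :> R by rewrite ltr0n.
have t1 : 1 <= t%:R :> R by rewrite ler1n.
have y0 : 0 < y by exact: expR_gt0.
have Lam0 : 0 < Lam by exact: lt_le_trans s_le.
have eta0 : 0 < eta by exact: divr_gt0.
have A0 : 0 < A by rewrite mulr_gt0 ?exprn_gt0 // divr_gt0.
have ks : (1 + 8 * a) * expR s <= k * s by rewrite -ler_pdivrMr // -mulrA.
have es : expR s <= k * s.
  by apply: le_trans ks; rewrite ler_peMl ?expR_ge0 // lerDl mulr_ge0 // ltW.
have k0 : 0 < k by have := lt_le_trans (expR_gt0 s) es; rewrite pmulr_lgt0.
have beta0 : 0 < beta by exact: mulr_gt0.
have m0 : 0 < m by rewrite /m mulr_gt0 // subr_gt0; lra.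
have s_le_y : s <= 4 * y / a.
  have := expR_ge1Dx (a * s / 4); rewrite -/y ler_pdivlMr //; lra.
have s_le_y2 : s <= 2 * y ^+ 2 / a.
  have -> : y ^+ 2 = expR (a * s / 2).
    by rewrite /y -expRM_natl; congr expR; field.
  have := expR_ge1Dx (a * s / 2); rewrite ler_pdivlMr //; lra.
have ya : 128 * t%:R ^+ 2 <= y * a.
  rewrite ler_pdivrMr ?exprn_gt0 // in y_ge2; apply: le_trans y_ge2 _.
  rewrite ler_wpM2l ?(ltW y0) // -[leRHS]expr1 ler_wiXn2l // ?ltW //; lra.
have A_big : 16 * t%:R ^+ 2 <= A / 4.
  have y1 : 1 <= y by nra.
  by rewrite /A; nra.
have A_le : A <= m * expR (- ((1 + t%:R^-1) * d / m)).
  (* The slack 8 a pays for 1/t <= a, for the loss of a k in m and for the saving of a s: (1 - a)^2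
     (1 + 8 a) >= 1 + a when a <= 1/8. *)
  have h1 : (1 + t%:R^-1) * d / m <= (1 - a) * s.
    rewrite ler_pdivrMr // /m.
    apply: (@le_trans _ _ ((1 + a) * expR s)).
      by apply: ler_pM => //; rewrite ?lerD2l // addr_ge0 ?invr_ge0.
    apply: (@le_trans _ _ ((1 - a) ^+ 2 * (k * s))); last first.
      by rewrite le_eqVlt; apply/orP; left; apply/eqP; ring.
    apply: (@le_trans _ _ ((1 - a) ^+ 2 * ((1 + 8 * a) * expR s))).
      by rewrite mulrA ler_wpM2r ?expR_ge0 //; nra.
    by rewrite ler_wpM2l // exprn_ge0 // subr_ge0; lra.
  have h2 : expR s / s <= m.
    rewrite ler_pdivrMr // /m -mulrA.
    apply: (@le_trans _ _ ((1 - a) * ((1 + 8 * a) * expR s))).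
      by rewrite mulrA -[leLHS]mul1r ler_wpM2r ?expR_ge0 //; nra.
    by rewrite ler_wpM2l // subr_ge0; lra.
  apply: (@le_trans _ _ (expR s / s * expR (- ((1 - a) * s)))); last first.
    apply: ler_pM; rewrite ?expR_ge0 //.
      by rewrite divr_ge0 ?expR_ge0 // ltW.
    by rewrite ler_expR lerN2.
  (* Here exp(a s) = y^4; dividing by s <= 2 y^2 / a leaves exactly A. *)
  have -> : expR s / s * expR (- ((1 - a) * s)) = y ^+ 4 / s.
    by rewrite mulrAC -expRD /y -expRM_natl; congr (expR _ / _); field.
  rewrite ler_pdivlMr // /A.
  apply: (@le_trans _ _ (a / 2 * y ^+ 2 * (2 * y ^+ 2 / a))).
    by rewrite ler_wpM2l ?(ltW A0).
  by rewrite le_eqVlt; apply/orP; left; apply/eqP; field; rewrite gt_eqF.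
have p_le : p <= s / (4 * Lam) + expR (- (A / 4)).
  rewrite lerD2r ler_pdivrMr //.
  have -> : s / (4 * Lam) * beta = q * (k * s) by rewrite /q /beta; ring.
  rewrite mulrC ler_wpM2l ?(le_trans d_le) //.
  by rewrite divr_ge0 ?mulr_ge0 // ltW.
have p_half : p <= 2^-1.
  apply: le_trans p_le _.
  have : s / (4 * Lam) <= 4^-1.
    by rewrite ler_pdivrMr ?mulr_gt0 //; lra.
  have : expR (- (A / 4)) <= 4^-1.
    rewrite expRN lef_pV2 ?posrE ?expR_gt0 //.
    have := expR_ge1Dx (A / 4); nra.
  lra.
split; split => //.
- by rewrite le_eqVlt; apply/orP; left; apply/eqP;
    rewrite /m /beta /eta; field; rewrite gt_eqF.
- by apply: le_lt_trans p_half _; lra.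
- by apply: le_trans A_big; nra.
apply: (@le_trans _ _ (q * (A / 8))); last first.
  apply: ler_wpM2l; first by rewrite ltW // divr_gt0 // mulr_gt0.
  nra.
(* A is quadratic in y while M s is at most 4 M y / a, so the first lower bound on y gives M s <= A
   / 4. *)
have LamE : Lam * expR (- (A / 4)) <= 1.
  apply: (@le_trans _ _ (expR (M * s) * expR (- (A / 4)))).
    by rewrite ler_wpM2r ?expR_ge0.
  rewrite -expRD -[leRHS]expR0 ler_expR subr_le0.
  apply: (@le_trans _ _ (M * (4 * y / a))); first by rewrite ler_wpM2l.
  rewrite ler_pdivrMr ?exprn_gt0 // in y_ge1.
  have : 4 * y * (32 * M) <= 4 * y * (y * a ^+ 2).
    by rewrite ler_wpM2l // mulr_ge0 // ltW.
  rewrite (mulrA M) ler_pdivrMr // /A; lra.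
have Lamp : Lam * p <= s / 4 + 1.
  apply: (@le_trans _ _ (Lam * (s / (4 * Lam) + expR (- (A / 4))))).
    by apply: ler_wpM2l => //; exact: ltW.
  rewrite mulrDr; apply: lerD => //.
  by rewrite le_eqVlt; apply/orP; left; apply/eqP; field; rewrite gt_eqF.
(* Multiplying by Lam leaves a left side at most linear in y against a quadratic right side; the
   second lower bound on y decides. *)
rewrite -(ler_pM2l Lam0) mulrCA.
apply: (@le_trans _ _ (t%:R * (s / 4 + 1))); first by rewrite ler_wpM2l.
have -> : Lam * (q * (A / 8)) = a * A / (32 * t%:R).
  by rewrite /q /eta; field; rewrite !gt_eqF.
rewrite ler_pdivlMr ?mulr_gt0 //.
have h1 : s / 4 + 1 <= 2 * y / a.
  move: s_le_y; rewrite !ler_pdivlMr // => h; nra.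
apply: (@le_trans _ _ (32 * t%:R ^+ 2 * (2 * y / a))).
  have -> : t%:R * (s / 4 + 1) * (32 * t%:R) = 32 * t%:R ^+ 2 * (s / 4 + 1) by ring.
  by rewrite ler_wpM2l // mulr_ge0 // exprn_ge0.
rewrite mulrA ler_pdivrMr // /A.
have : y * (128 * t%:R ^+ 2) <= y * (y * a ^+ 3).
  by rewrite ler_wpM2l ?(ltW y0) // -ler_pdivrMr // exprn_gt0.
lra.
Qed.

(* log d with degrees below delta rounded up to delta. *)
Definition log_degree (R : realType) (dl : R) (d : nat) : R :=
  Num.max (ln d%:R) (ln dl).

Lemma le_expR_log_degree (R : realType) (dl : R) (d : nat) :
  d%:R <= expR (log_degree dl d).
Proof.
case: d => [|d]; first exact: expR_ge0.
by rewrite -[leLHS]lnK ?posrE ?ltr0n // ler_expR le_max lexx.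
Qed.

(** Whichever logarithm is larger, exp(s)/s is the matching quotient. For d <= 1 it is that of
    delta, as ln d <= 0 (with ln 0 = 0 by default), in agreement with the convention. *)
Lemma max_ratio_ge (R : realType) (dl : R) (d : nat) : 1 < dl ->
  expR (log_degree dl d) / log_degree dl d <= max_ratio dl d.
Proof.
move=> dl1; have dl0 : 0 < dl by apply: lt_trans dl1.
have lndl : 0 < ln dl by rewrite ln_gt0.
rewrite /max_ratio /log_degree; case: leqP => d1.
  have lnd : ln (d%:R : R) <= 0 by apply: ln_le0; rewrite lern1.
  by rewrite (max_idPr (le_trans lnd (ltW lndl))) lnK.
have d0 : 0 < d%:R :> R by rewrite ltr0n ltnW.
by rewrite le_max; case: (leP (ln d%:R) (ln dl)) => _;
  rewrite lnK ?posrE // lexx ?orbT.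
Qed.

(** * Choice of constants and assembly *)

Theorem theorem1 (R : realType) (eps : R) (eps_gt0 : 0 < eps) :
  exists D0 : nat, forall D : nat, (D0 <= D)%N ->
  forall (V : finType) (adj : rel V),
    simple_graph adj -> triangle_free adj -> max_degree adj = D ->
  forall L : V -> set nat,
    list_assignment L ->
    (forall v : V,
       (((1 + eps) * max_ratio (delta eps D) (degree adj v))%:E
          <= (counting (L v) : \bar R))%E) ->
  exists c : V -> nat,
    proper_colouring adj c /\ (forall v : V, L v (c v)).
Proof.
pose a : R := Num.min eps 1 / 8.
have a_gt0 : 0 < a by rewrite divr_gt0 // lt_min eps_gt0 ltr01.
have a_le : a <= 8^-1 by rewrite ler_pdivrMr // mulVf // ge_min lexx orbT.
have a_eps : 8 * a <= eps by rewrite mulrC divfK // ge_min lexx.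
pose t := (Num.trunc a^-1).+1.
have t0 : (0 < t)%N by [].
have at1 : t%:R^-1 <= a.
  rewrite -[leRHS]invrK lef_pV2 ?posrE ?invr_gt0 ?ltr0n //.
  exact/ltW/truncnS_gt.
(* The exponent for which delta^M = 192 log Delta. *)
pose M : R := eps / 2.
have M0 : 0 < M by exact: divr_gt0.
pose Y : R := 32 * M / a ^+ 2 + 128 * t%:R ^+ 2 / a ^+ 3.
have Y1 : 0 < 32 * M / a ^+ 2 by rewrite divr_gt0 ?exprn_gt0 // mulr_gt0.
have Y2 : 0 < 128 * t%:R ^+ 2 / a ^+ 3.
  by rewrite divr_gt0 ?exprn_gt0 // mulr_gt0 // exprn_gt0 // ltr0n.
(* The first summand forces log delta >= 4 Y / a, hence exp(a s / 4) >= Y at every vertex; the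
   second forces log delta <= Lam. *)
pose Lam0 : R := expR (M * (4 * Y / a)) + (2 / M) ^+ 2.
exists (Num.trunc (expR Lam0)).+1 => D D0.
pose Lam : R := 192 * ln D%:R.
have lnD : Lam0 <= ln D%:R.
  rewrite -(expRK Lam0) ler_ln ?posrE ?expR_gt0 //.
    by apply: ltW; apply: lt_le_trans (truncnS_gt _) _; rewrite ler_nat.
  by rewrite ltr0n; apply: leq_trans D0.
have Lam00 : 0 < Lam0 by rewrite addr_gt0 ?expR_gt0 // exprn_gt0 // divr_gt0.
have lnDLam : ln D%:R <= Lam by rewrite /Lam; lra.
have LamLam0 : Lam0 <= Lam by exact: le_trans lnDLam.
have Lam_gt0 : 0 < Lam by exact: lt_le_trans LamLam0.
pose dl := delta eps D.
have ln_dl : M * ln dl = ln Lam.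
  by rewrite /dl /delta ln_powR -/Lam /M; field; rewrite gt_eqF.
have ln_dl_ge : 4 * Y / a <= ln dl.
  rewrite -(ler_pM2l M0) ln_dl -[leLHS]expRK ler_ln ?posrE ?expR_gt0 //.
  by apply: le_trans LamLam0; rewrite lerDl exprn_ge0 // divr_ge0 // ltW.
have ln_dl_gt0 : 0 < ln dl.
  by apply: lt_le_trans ln_dl_ge; rewrite divr_gt0 // mulr_gt0 // addr_gt0.
have dl1 : 1 < dl.
  rewrite ltNge; apply: contraTN ln_dl_gt0 => /ln_le0.
  by rewrite leNgt.
have ln_dl_le : ln dl <= Lam.
  rewrite -(ler_pM2l M0) ln_dl.
  (* With z the square root of Lam, log Lam <= 2 z <= M z^2, since z >= 2 / M. *)
  have sq : Lam = expR (ln Lam / 2) ^+ 2.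
    by rewrite -expRM_natl -[LHS]lnK ?posrE //; congr expR; field.
  have h1 := expR_ge1Dx (ln Lam / 2).
  have h2 : (2 / M) ^+ 2 <= expR (ln Lam / 2) ^+ 2.
    by rewrite -sq; apply: le_trans LamLam0; rewrite lerDr expR_ge0.
  have h3 : 2 / M <= expR (ln Lam / 2).
    by move: h2; rewrite ler_pXn2r ?nnegrE ?expR_ge0 ?divr_ge0 // ltW.
  rewrite ler_pdivrMr // in h3.
  rewrite [in leRHS]sq expr2 mulrA.
  have := expR_gt0 (ln Lam / 2).
  set z := expR _ in h1 h3 *; move=> z0.
  apply: (@le_trans _ _ (2 * z)); first lra.
  by rewrite ler_wpM2r ?(ltW z0) // mulrC.
move=> V adj [adj_sym adj_irr] adj_tri maxD L _ Lsize.
have [n [L' [L'size L'L]]] := finite_sublists Lsize.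
pose s v := log_degree dl (degree adj v).
pose k v : R := #|L' v|%:R.
have s_ge v : ln dl <= s v by rewrite le_max lexx orbT.
have s_gt0 v : 0 < s v by apply: lt_le_trans (s_ge v).
have k_ge v : (1 + 8 * a) * (expR (s v) / s v) <= k v.
  apply: le_trans (L'size v); apply: ler_pM.
  - by rewrite addr_ge0 // mulr_ge0 // ltW.
  - by rewrite divr_ge0 ?expR_ge0 // ltW.
  - by rewrite lerD2l.
  - exact: max_ratio_ge.
have d_le v : (degree adj v)%:R <= expR (s v) by exact: le_expR_log_degree.
have s_le v : s v <= Lam.
  rewrite ge_max ln_dl_le andbT.
  have [->|dv] := posnP (degree adj v); first by rewrite ln0 // ltW.
  apply: le_trans lnDLam; rewrite ler_ln ?posrE ?ltr0n //.
    by rewrite ler_nat -maxD leq_bigmax.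
  by apply: leq_trans D0.
have Lam_le v : Lam <= expR (M * s v).
  by rewrite -[leLHS]lnK ?posrE // ler_expR -ln_dl ler_wpM2l // ltW.
have y_ge v : Y <= expR (a * s v / 4).
  have h : 4 * Y <= a * s v.
    by rewrite mulrC [leRHS]mulrC -ler_pdivrMr // mulrC (le_trans ln_dl_ge).
  have := expR_ge1Dx (a * s v / 4); lra.
have y_ge1 v : 32 * M / a ^+ 2 <= expR (a * s v / 4).
  by apply: le_trans (y_ge v); rewrite lerDl ltW.
have y_ge2 v : 128 * t%:R ^+ 2 / a ^+ 3 <= expR (a * s v / 4).
  by apply: le_trans (y_ge v); rewrite lerDr ltW.
have M_ge0 := ltW M0.
have const v := constants_suffice a_gt0 a_le M_ge0 t0 at1 (s_gt0 v) (k_ge v)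
  (ler0n R (degree adj v)) (d_le v) (s_le v) (Lam_le v) (y_ge1 v) (y_ge2 v).
have [c [cP cL]] : exists c : V -> 'I_n,
    (forall u v, adj u v -> c u <> c v) /\ (forall v, c v \in L' v).
  have q0 : 0 <= a / t%:R / (4 * Lam).
    by apply/ltW/divr_gt0; [rewrite divr_gt0 // ltr0n | rewrite mulr_gt0].
  apply: (@list_colouring_exists R _ _ _ _ adj_sym adj_irr adj_tri t
    (a / t%:R / (4 * Lam)) (fun v => a / t%:R * k v) (fun v => (1 - a) * k v)
    (fun v => a / 2 * expR (a * s v / 4) ^+ 2) t0 q0);
    by move=> v; have [[? ? ? ?] [? ? ?]] := const v.
exists (fun v => c v); split; last by move=> v; apply: L'L.
by move=> u v uv /val_inj; apply: cP.
Qed.
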